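(* For every integer $k\ge 1$ there is a constant $c_k>0$, depending only on $k$, such that the following holds. Let $(V,\mathcal{C})$ be an instance of a $B$-bounded occurrence ordering $k$-CSP problem, where $B\ge 1$ is an integer. Then the ordering $\pi_{\mathrm{Alg}}$ returned by the Randomized Local Search Algorithm on input $(V,\mathcal{C})$ satisfies $$\mathbb{E}\,\mathrm{val}(\pi_{\mathrm{Alg}},\mathcal{C}) \;\ge\; \mathrm{Avg}(V,\mathcal{C}) + c_k\, B^{-(k+2)}\big(\mathrm{Opt}(V,\mathcal{C})-\mathrm{Avg}(V,\mathcal{C})\big),$$ where the expectation is over the internal randomness of the algorithm.
   Context: An instance of an ordering $k$-CSP is a pair $(V,\mathcal{C})$, where $V$ is a finite set of $n$ vertices and $\mathcal{C}$ is a finite set of constraints. An ordering is a bijection $\pi:V\to\{1,\dots,n\}$; let $\mathrm{Sym}_V$ be the set of all orderings. Each constraint $C\in\mathcal{C}$ is a function $C:\mathrm{Sym}_V\to\mathbb{R}_{\ge 0}$ for which there is a set $T_C\subseteq V$ with $|T_C|\le k$ such that whenever two orderings $\pi_1,\pi_2$ satisfy ($\pi_1(u)<\pi_1(v)\iff\pi_2(u)<\pi_2(v)$) for all $u,v\in T_C$, we have $C(\pi_1)=C(\pi_2)$ (i.e., $C$ depends only on the relative order of the at most $k$ vertices of $T_C$). The instance is $B$-bounded occurrence if every vertex $v\in V$ belongs to $T_C$ for at most $B$ constraints $C\in\mathcal{C}$. The value of an ordering is $\mathrm{val}(\pi,\mathcal{C})=\sum_{C\in\mathcal{C}}C(\pi)$;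 $\mathrm{Opt}(V,\mathcal{C})=\max_{\pi\in\mathrm{Sym}_V}\mathrm{val}(\pi,\mathcal{C})$ and $\mathrm{Avg}(V,\mathcal{C})=\frac{1}{n!}\sum_{\pi\in\mathrm{Sym}_V}\mathrm{val}(\pi,\mathcal{C})$. For a list $(u_1,\dots,u_n)$ of all vertices, $\mathrm{val}((u_1,\dots,u_n),\mathcal{C})$ denotes $\mathrm{val}(\pi,\mathcal{C})$ for $\pi:u_i\mapsto i$. Randomized Local Search Algorithm (input $(V,\mathcal{C})$, output an ordering of $V$): (1) Arrange all vertices in a uniformly random order. (2) Repeat $n$ times: pick a vertex $u\in V$ uniformly at random (independently each time); letting $v_1,\dots,v_{n-1}$ be the current ordering of all vertices other than $u$, choose a position $i\in\{1,\dots,n\}$ maximizing the value of the ordering obtained by inserting $u$ into position $i$ of $(v_1,\dots,v_{n-1})$ (keeping the relative order of the other vertices), and put $u$ in that position. (3) Return the resulting ordering. *)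

(* Defs.v *)
From Stdlib Require List.
From mathcomp Require Import all_boot all_order all_algebra.
Set Implicit Arguments. Unset Strict Implicit. Unset Printing Implicit Defensive.
Import Order.TTheory GRing.Theory Num.Theory.
Local Open Scope ring_scope.

Section OrderingCSP.
Variables (R : realFieldType) (V : finType).

(* An ordering of V is represented by the list (u_1, ..., u_n) of all vertices:
   a list s with perm_eq s (enum V); the position of v is pi(v) = index v s + 1. *)
Definition is_ordering (s : seq V) : bool := perm_eq s (enum V).

Definition orderings : seq (seq V) := permutations (enum V).

Record constraint := Constraint { supp : {set V}; cval : seq V -> R }.

Definition is_kconstraint (k : nat) (C : constraint) : Prop :=
  [/\ (#|supp C| <= k)%N,
      forall s, is_ordering s -> 0 <= cval C s
    & forall s1 s2, is_ordering s1 -> is_ordering s2 ->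
        (forall u v, u \in supp C -> v \in supp C ->
           (index u s1 < index v s1)%N = (index u s2 < index v s2)%N) ->
        cval C s1 = cval C s2].

Definition kcsp_instance (k : nat) (cs : seq constraint) : Prop :=
  forall C, List.In C cs -> is_kconstraint k C.

Definition bounded_occ (B : nat) (cs : seq constraint) : Prop :=
  forall v : V, (count (fun C => v \in supp C) cs <= B)%N.

Definition value (cs : seq constraint) (s : seq V) : R :=
  \sum_(C <- cs) cval C s.

Definition Opt (cs : seq constraint) : R :=
  \big[Num.max/0]_(s <- orderings) value cs s.

Definition Avg (cs : seq constraint) : R :=
  (\sum_(s <- orderings) value cs s) / (size orderings)%:R.

Definition ins (s : seq V) (u : V) (i : nat) : seq V :=
  let s' := rem u s in take i s' ++ u :: drop i s'.

(* A tie-breaking rule: at step t, with current ordering s and chosen vertex u,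
   returns a 0-based position (among 0..n-1) maximizing the value after insertion. *)
Definition valid_rule (cs : seq constraint) (tb : nat -> seq V -> V -> nat) : Prop :=
  forall t s u, is_ordering s ->
    (tb t s u < #|V|)%N /\
    forall j, (j < #|V|)%N -> value cs (ins s u j) <= value cs (ins s u (tb t s u)).

Definition run (tb : nat -> seq V -> V -> nat) (s0 : seq V)
  (f : {ffun 'I_#|V| -> V}) : seq V :=
  foldl (fun s (t : 'I_#|V|) => ins s (f t) (tb (t : nat) s (f t))) s0 (enum 'I_#|V|).

(* Expected value of the output: uniform random start ordering, and n independent
   uniform vertex picks. *)
Definition expected_alg_value (cs : seq constraint) (tb : nat -> seq V -> V -> nat) : R :=
  (\sum_(s0 <- orderings) \sum_(f : {ffun 'I_#|V| -> V}) value cs (run tb s0 f))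
  / ((size orderings)%:R * (#|{ffun 'I_#|V| -> V}|)%:R).

End OrderingCSP.

(* Main.v *)
From Stdlib Require List.
Require Import Defs.
From mathcomp Require Import all_boot all_order all_algebra.
From mathcomp Require Import zify ring.
Import Order.TTheory GRing.Theory Num.Theory.
Set Implicit Arguments. Unset Strict Implicit. Unset Printing Implicit Defensive.
Local Open Scope ring_scope.

(** Let [gain u s] be the best improvement obtained by reinserting [u] into
    [s].  It only depends on the order that [s] induces on [nbhd u], i.e. [u]
    and the vertices sharing a constraint with it, at most [B(k+1)] in number.

    If no vertex of [nbhd u] was picked before [u] is picked, that step gains
    exactly [gain u] of the initial, uniformly random, ordering.  Over the whole
    run this happens with total weight at least [1/(2B(k+1))] for each [u], so
    the algorithm beats the average by [sum_u E (gain u) / (2B(k+1))].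

    Conversely, fix a target ordering [p], and let [F A] be the expected value
    of a random ordering in which the vertices of [A] are moved to the end and
    arranged as in [p].  Then [F set0 = Avg] and [F setT = value p], so by
    Moebius inversion [value p - Avg] is the sum over nonempty [S] of
    coefficients that vanish unless [S] lies in the support of a constraint.
    For any [u] in [S], the coefficient of [S] is a signed sum of differences
    [F A - F (A :\ u)] with [u \in A \subset S].  The two orderings compared
    differ by reinserting [u], and on [nbhd u] their law has density at most
    [#|nbhd u| ^ #|A|] with respect to the uniform one, so each difference is at
    most [(B(k+1))^k E (gain u)] in absolute value. *)

(** * Relative order in lists, and rearrangement of sublists *)

Section Lists.
Variable T : eqType.
Implicit Types (s e : seq T) (a b u x : T).

Definition before s a b : bool := (index a s < index b s)%N.

Lemma before_filter (p : pred T) s a b :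
  p a -> p b -> before (filter p s) a b = before s a b.
Proof.
move=> pa pb; rewrite /before; elim: s => //= x s IH.
case: ifP => px /=.
  by case: (x == a); case: (x == b).
have -> : (x == a) = false by apply: contraFF px => /eqP ->.
have -> : (x == b) = false by apply: contraFF px => /eqP ->.
by rewrite IH.
Qed.

Lemma before_antisym s a b : a \in s -> a != b -> before s b a = ~~ before s a b.
Proof.
move=> sa ab; rewrite /before; case: ltngtP => //= eqi.
by case/eqP: ab; apply: (index_inj a sa _ (esym eqi)); rewrite -index_mem eqi index_mem.
Qed.

Definition agree (D : pred T) s t : Prop :=
  forall a b, D a -> D b -> before s a b = before t a b.

Lemma agree_filter (D : pred T) s t : filter D s = filter D t -> agree D s t.
Proof. by move=> eqst a b Da Db; rewrite -(before_filter s Da Db) eqst before_filter. Qed.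

Definition mv_last u s : seq T := rcons (rem u s) u.

Lemma filter_rem (p : pred T) u s : uniq s -> filter p (rem u s) = rem u (filter p s).
Proof.
move=> us; rewrite !rem_filter ?filter_uniq // -!filter_predI.
by apply: eq_filter => x /=; rewrite andbC.
Qed.

Lemma take_index_rem u s : take (index u s) (rem u s) ++ u :: drop (index u s) (rem u s)
  = if u \in s then s else rcons s u.
Proof.
elim: s => //= x s IH; rewrite inE (eq_sym u x); case: eqP => [-> | _] /=.
  by rewrite take0 drop0.
by rewrite IH; case: ifP.
Qed.

Lemma mv_last_perm u s : u \in s -> perm_eq (mv_last u s) s.
Proof. by move=> su; rewrite perm_rcons perm_sym perm_to_rem. Qed.

(** When [e] and [e'] have the same size, an [x] outside [e] has index [size e], past the end of
    [e'], so [nth] returns its default [x]: the place-by-place map from [e] to [e'] is extended by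
    the identity. *)
Definition transfer e e' x : T := nth x e' (index x e).

(* Puts the entries of e' at the places that the entries of e occupy in s. *)
Definition refill e e' s : seq T := map (transfer e e') s.

Lemma transferK e e' : perm_eq e e' -> uniq e ->
  cancel (transfer e e') (transfer e' e).
Proof.
move=> pe ue x; have ue' : uniq e' by rewrite -(perm_uniq pe).
rewrite /transfer; case: (boolP (x \in e)) => ex.
  have lt : (index x e < size e')%N by rewrite -(perm_size pe) index_mem.
  rewrite index_uniq //.
  by rewrite (set_nth_default x) ?nth_index ?index_mem.
have ex' : x \notin e' by rewrite -(perm_mem pe).
have -> : nth x e' (index x e) = x.
  by rewrite nth_default // -(perm_size pe) leqNgt index_mem.
by rewrite nth_default // (perm_size pe) leqNgt index_mem.
Qed.

Lemma refillK e e' s : perm_eq e e' -> uniq e -> refill e' e (refill e e' s) = s.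
Proof. by move=> pe ue; apply: mapK; apply: transferK. Qed.

Lemma refill_self e e' : size e = size e' -> uniq e -> refill e e' e = e'.
Proof.
move=> se ue; case: e se ue => [|x0 e0]; first by move/esym/size0nil => ->.
set e := x0 :: e0 => se ue.
apply: (@eq_from_nth _ x0); rewrite size_map // => i lti.
rewrite (nth_map x0) // /transfer index_uniq //.
by apply: set_nth_default; rewrite -se.
Qed.

Lemma filter_refill (D : pred T) s e' :
  perm_eq (filter D s) e' -> uniq s -> filter D (refill (filter D s) e' s) = e'.
Proof.
move=> pe us; have ue : uniq (filter D s) by rewrite filter_uniq.
rewrite /refill filter_map -[RHS](refill_self (perm_size pe) ue) /refill /transfer.
congr map; apply: eq_in_filter => x sx /=.
case: (boolP (D x)) => Dx.
  have: nth x e' (index x (filter D s)) \in e'.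
    by rewrite mem_nth // -(perm_size pe) index_mem mem_filter Dx.
  by rewrite -(perm_mem pe) mem_filter => /andP[].
rewrite nth_default ?(negbTE Dx) //.
by rewrite -(perm_size pe) leqNgt index_mem mem_filter (negbTE Dx).
Qed.

End Lists.

(** * Comparison of sums along maps with small fibres *)

Section Sums.
Variables (R : realFieldType) (T : eqType).

Lemma ler_sum_uniq_sub (X Y : seq T) (G : T -> R) :
  uniq X -> uniq Y -> {subset Y <= X} -> (forall x, x \in X -> 0 <= G x) ->
  \sum_(x <- Y) G x <= \sum_(x <- X) G x.
Proof.
move=> uX uY sYX G0.
have pY : perm_eq Y [seq x <- X | x \in Y].
  apply: uniq_perm; rewrite ?filter_uniq // => x; rewrite mem_filter.
  by case: (boolP (x \in Y)) => //= /sYX ->.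
rewrite (perm_big _ pY) /= big_filter big_mkcond /= big_seq [leRHS]big_seq.
by apply: ler_sum => x Xx; case: ifP => // _; apply: G0.
Qed.

(** On each level set of [r] the map [f] is injective with values in [X], so each of the [d] levels
    contributes at most one full sum. *)
Lemma ler_sum_fiber (X : seq T) (G : T -> R) (f : T -> T) (r : T -> nat) (d : nat) :
  uniq X -> (forall x, x \in X -> 0 <= G x) ->
  (forall x, x \in X -> f x \in X /\ (r x < d)%N) ->
  {in X &, forall x y, f x = f y -> r x = r y -> x = y} ->
  \sum_(x <- X) G (f x) <= d%:R * \sum_(x <- X) G x.
Proof.
move=> uX G0 fX inj.
have -> : \sum_(x <- X) G (f x) = \sum_(i < d) \sum_(x <- X | r x == i) G (f x).
  rewrite (exchange_big_dep xpredT) //= big_seq [RHS]big_seq; apply: eq_bigr => x Xx.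
  have [_ rx] := fX x Xx.
  by rewrite (big_pred1 (Ordinal rx)) // => i; apply: eq_sym.
have -> : d%:R * \sum_(x <- X) G x = \sum_(i < d) \sum_(x <- X) G x.
  by rewrite sumr_const card_ord mulr_natl.
apply: ler_sum => i _.
rewrite -big_filter -(big_map f xpredT G); apply: ler_sum_uniq_sub => //.
  rewrite map_inj_in_uniq ?filter_uniq // => x y.
  rewrite !mem_filter => /andP[/eqP rx Xx] /andP[/eqP ry Xy] eqf.
  by apply: inj; rewrite ?rx ?ry.
by move=> y /mapP[x]; rewrite mem_filter => /andP[_ /fX[fXx _]] ->.
Qed.

End Sums.

(** * Moebius inversion over subsets *)

Section Moebius.
Variables (R : realFieldType) (V : finType) (phi : {set V} -> R).

(** For [A] inside [S], the exponent has the parity of [#|S :\: A|]. *)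
Definition moebius (S : {set V}) : R :=
  \sum_(A : {set V} | A \subset S) (-1) ^+ (#|S| + #|A|) * phi A.

Lemma big_setD1_pair (F : {set V} -> R) (u : V) (S : {set V}) : u \in S ->
  \sum_(A : {set V} | A \subset S) F A =
  \sum_(A : {set V} | (A \subset S) && (u \in A)) (F A + F (A :\ u)).
Proof.
move=> Su; rewrite (bigID (fun A : {set V} => u \in A)) big_split /=; congr (_ + _).
rewrite (reindex_onto (fun A : {set V} => A :\ u) (fun A => u |: A)) /=; last first.
  by move=> A /andP[_ nAu]; rewrite setU1K.
apply: eq_bigl => A; rewrite setD11 andbT.
case: (boolP (u \in A)) => Au; last first.
  rewrite andbF; apply/negbTE; rewrite negb_and; apply/orP; right.
  by apply: contraNneq Au => <-; rewrite setU11.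
rewrite setD1K // eqxx !andbT subDset.
by have /setUidPr -> : [set u] \subset S by rewrite sub1set.
Qed.

Lemma moebius_pair (u : V) (S : {set V}) : u \in S ->
  moebius S =
  \sum_(A : {set V} | (A \subset S) && (u \in A))
    (-1) ^+ (#|S| + #|A|) * (phi A - phi (A :\ u)).
Proof.
move=> Su; rewrite /moebius (big_setD1_pair _ Su); apply: eq_bigr => A /andP[_ Au].
by rewrite (cardsD1 u A) Au add1n addnS exprS mulN1r mulrBr !mulNr opprK.
Qed.

Lemma moebius_set0 : moebius set0 = phi set0.
Proof.
rewrite /moebius (big_pred1 set0) => [|A]; last by rewrite subset0.
by rewrite cards0 mul1r.
Qed.

Lemma moebius_inversion : \sum_(S : {set V}) moebius S = phi [set: V].
Proof.
rewrite /moebius (exchange_big_dep xpredT) //= (bigD1 setT) //= [X in _ + X]big1.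
  rewrite (big_pred1 setT) => [|S]; last by rewrite subTset.
  by rewrite addnn -signr_odd odd_double mul1r addr0.
(* A vertex [u] outside [A] splits the supersets of [A] into pairs of opposite sign. Passing to
   complements turns them into subsets of [~: A], to which [big_setD1_pair] applies. *)
move=> A; rewrite -subTset => /subsetPn[u _ nAu].
rewrite -mulr_suml (_ : \sum_(_ | _) _ = 0) ?mul0r //.
rewrite (reindex_inj (@setC_inj _)) /=.
rewrite (eq_bigl (fun S : {set V} => S \subset ~: A)); last first.
  by move=> S; rewrite /= -setCS setCK.
rewrite (@big_setD1_pair _ u) ?inE // big1 // => S /andP[_ Su].
have -> : (#|~: (S :\ u)| = #|~: S|.+1)%N.
  by have := cardsC S; have := cardsC (S :\ u); rewrite (cardsD1 u S) Su add1n; lia.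
by rewrite addSn exprS mulN1r subrr.
Qed.

End Moebius.

(** * Orderings, reinsertion of a vertex, and moving a vertex last *)

Section Orderings.
Variable V : finType.
Implicit Types (s t p l : seq V) (u v w a b : V) (A D : {set V}).

Lemma ordering_uniq s : is_ordering s -> uniq s.
Proof. by move=> /perm_uniq ->; apply: enum_uniq. Qed.

Lemma mem_ordering s : is_ordering s -> forall u, u \in s.
Proof. by move=> os u; rewrite (perm_mem os) mem_enum. Qed.

Lemma size_ordering s : is_ordering s -> size s = #|V|.
Proof. by move=> os; rewrite (perm_size os) cardE. Qed.

Lemma orderingP s : uniq s -> (forall u, u \in s) -> is_ordering s.
Proof.
move=> us ms; apply: uniq_perm; rewrite ?enum_uniq // => u.
by rewrite ms mem_enum.
Qed.

Lemma mem_orderings s : (s \in orderings V) = is_ordering s.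
Proof. exact: mem_permutations. Qed.

Lemma orderings_uniq : uniq (orderings V).
Proof. exact: permutations_uniq. Qed.

Lemma size_orderings_gt0 : (0 < size (orderings V))%N.
Proof.
by rewrite -has_predT; apply/hasP; exists (enum V); rewrite // mem_orderings /is_ordering.
Qed.

Lemma size_rem_ordering s u : is_ordering s -> (size (rem u s)).+1 = #|V|.
Proof.
move=> os; rewrite size_rem ?mem_ordering // size_ordering // prednK //.
by apply/card_gt0P; exists u.
Qed.

Lemma ins_ordering s u i : is_ordering s -> is_ordering (ins s u i).
Proof.
move=> os; rewrite /is_ordering -(permPr os) /ins -cat1s perm_catCA cat_take_drop.
by rewrite /= perm_sym perm_to_rem ?mem_ordering.
Qed.

Lemma rem_ins s u i : is_ordering s -> rem u (ins s u i) = rem u s.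
Proof.
move=> os; have us := ordering_uniq os.
rewrite rem_filter ?(ordering_uniq (ins_ordering _ _ _)) // /ins.
rewrite filter_cat /= eqxx /= -filter_cat cat_take_drop.
by rewrite rem_filter // filter_id.
Qed.

Lemma before_rem s u a b : uniq s -> a != u -> b != u ->
  before (rem u s) a b = before s a b.
Proof. by move=> us au bu; rewrite rem_filter // before_filter. Qed.

Lemma before_ins s u i a b : is_ordering s -> a != u -> b != u ->
  before (ins s u i) a b = before s a b.
Proof.
move=> os au bu; rewrite -(before_rem (ordering_uniq (ins_ordering u i os)) au bu).
by rewrite rem_ins // before_rem // ordering_uniq.
Qed.

Lemma before_ins_r s u i a : is_ordering s -> (i < #|V|)%N -> a != u ->
  before (ins s u i) a u = (index a (rem u s) < i)%N.
Proof.
move=> os lti au; have us := ordering_uniq os.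
have sr : a \in rem u s by rewrite rem_filter // mem_filter /= au mem_ordering.
have nu : u \notin take i (rem u s).
  by apply/negP => /mem_take; rewrite mem_rem_uniq // inE eqxx.
rewrite /before /ins !index_cat (negbTE nu) in_take //= eqxx addn0.
have si : size (take i (rem u s)) = i.
  by rewrite size_takel // -ltnS size_rem_ordering.
rewrite si; case: (ltnP (index a (rem u s)) i) => [lt|_].
  have: a \in take i (rem u s) by rewrite in_take ?lt.
  by rewrite -index_mem si.
by rewrite (eq_sym u a) (negbTE au) ltnNge addnS leqW ?leq_addr.
Qed.

Lemma ins_index s t u : is_ordering s -> is_ordering t -> rem u t = rem u s ->
  ins s u (index u t) = t.
Proof. by move=> os ot eqr; rewrite /ins -eqr take_index_rem mem_ordering. Qed.

Lemma index_ordering s u : is_ordering s -> (index u s < #|V|)%N.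
Proof. by move=> os; rewrite -(size_ordering os) index_mem mem_ordering. Qed.

(** Apart from [u], the vertices of [D] that end up before [u] form an initial segment of [D], in
    the order common to [s] and [t]. Placing [u] in [t] right after the last of them reproduces the
    order on [D]. *)
Lemma agree_ins s t u i D : is_ordering s -> is_ordering t -> (i < #|V|)%N ->
  agree (mem D) s t ->
  exists2 j, (j < #|V|)%N & agree (mem D) (ins s u i) (ins t u j).
Proof.
move=> os ot lti Dst.
pose P := [pred w | [&& w \in D, w != u & (index w (rem u s) < i)%N]].
(* The empty maximum gives position [0], as it should when nothing in [D] precedes [u]. *)
pose j := (\max_(w | P w) (index w (rem u t)).+1)%N.
have ltj : (j < #|V|)%N.
  rewrite -(size_rem_ordering u ot) ltnS; apply/bigmax_leqP => w /and3P[_ wu _].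
  by rewrite index_mem rem_filter ?ordering_uniq // mem_filter /= wu mem_ordering.
have key w : w \in D -> w != u ->
    (index w (rem u s) < i)%N = (index w (rem u t) < j)%N.
  move=> Dw wu; apply/idP/idP => [lt | ].
    by apply: (leq_bigmax_cond (F := fun w => (index w (rem u t)).+1)); rewrite /P /= Dw wu.
  (* Either some [w'] in [P] is not before [w] in [t], hence not in [s] either, which forces the
     index of [w] below [i]; or all of [P] precedes [w] in [t], and [j] is at most the index of
     [w]. *)
  have [/existsP[w' /andP[/and3P[Dw' wu' lt'] le]] _|/existsPn nex] :=
    boolP [exists w', P w' && (index w (rem u t) <= index w' (rem u t))%N].
    have: ~~ before (rem u s) w' w.
      by rewrite before_rem ?ordering_uniq // Dst // -(@before_rem t u) ?ordering_uniq // /before -leqNgt.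
    by rewrite /before -leqNgt => le'; apply: leq_ltn_trans lt'.
  rewrite ltnNge => /negP[]; apply/bigmax_leqP => w' Pw'.
  by have := nex w'; rewrite Pw' -ltnNge.
exists j => // a b /= Da Db.
have [->|au] := eqVneq a u; have [->|bu] := eqVneq b u.
- by rewrite /before !ltnn.
- rewrite before_antisym ?mem_ordering ?ins_ordering //.
  rewrite [RHS]before_antisym ?mem_ordering ?ins_ordering //.
  by rewrite !before_ins_r // key.
- by rewrite !before_ins_r // key.
- by rewrite !before_ins // Dst.
Qed.

Lemma mv_last_ordering s u : is_ordering s -> is_ordering (mv_last u s).
Proof. by move=> os; rewrite /is_ordering (permPl (mv_last_perm _)) ?mem_ordering. Qed.

Lemma before_rcons s a b u : a \in s -> u \notin s -> uniq s -> (b \in s) || (b == u) ->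
  before (rcons s u) a b = if b == u then true else before s a b.
Proof.
move=> sa su us; rewrite /before -cats1 !index_cat sa.
case: (eqVneq b u) => [-> _|bu]; rewrite ?(negbTE su) /= ?eqxx.
  by rewrite addn0 index_mem sa.
by rewrite orbF => ->.
Qed.

Lemma agree_mv_last s t D u : is_ordering s -> is_ordering t ->
  agree (mem D) s t -> agree (mem D) (mv_last u s) (mv_last u t).
Proof.
move=> os ot Dst a b /= Da Db.
have H r : is_ordering r ->
    before (mv_last u r) a b = (a != u) && ((b == u) || before r a b).
  move=> or; have ur := ordering_uniq or.
  have mr w : (w \in rem u r) = (w != u).
    by rewrite rem_filter // mem_filter /= mem_ordering ?andbT.
  have [au|au] := eqVneq a u.
    rewrite /before /mv_last au -cats1 !index_cat /= eqxx mr eqxx addn0 /=.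
    apply/negbTE; rewrite -leqNgt; case: ifP => [br|nbr].
      by rewrite ltnW // index_mem.
    by move: nbr; rewrite mr => /negbFE/eqP ->; rewrite eqxx addn0.
  rewrite /mv_last before_rcons ?mr ?eqxx ?orNb ?rem_uniq //=.
  by case: eqVneq => //= bu; rewrite before_rem.
by rewrite !H // Dst.
Qed.

Definition local_to (R : Type) D (G : seq V -> R) : Prop :=
  forall s t, is_ordering s -> is_ordering t -> agree (mem D) s t -> G s = G t.

(* Mapping [s] to the ordering in which the elements of [D] keep their set of
   places but [v] comes last among them is at most [#|D|]-to-one: [s] is
   recovered from its image and the rank of [v] in [D]. *)
Lemma sum_mv_last (R : realFieldType) (D : {set V}) v (G : seq V -> R) :
  D != set0 -> local_to D G -> (forall s, is_ordering s -> 0 <= G s) ->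
  \sum_(s <- orderings V) G (mv_last v s) <= #|D|%:R * \sum_(s <- orderings V) G s.
Proof.
move=> D0 locG G0.
have [Dv|nDv] := boolP (v \in D); last first.
  have -> : \sum_(s <- orderings V) G (mv_last v s) = \sum_(s <- orderings V) G s.
    rewrite big_seq [RHS]big_seq; apply: eq_bigr => s; rewrite mem_orderings => os.
    apply: locG => //; first exact: mv_last_ordering.
    apply: agree_filter; rewrite filter_rcons /= (negbTE nDv) filter_rem ?ordering_uniq //.
    by rewrite rem_id // mem_filter /= (negbTE nDv).
  rewrite ler_peMl ?ler1n ?card_gt0 // big_seq sumr_ge0 // => s.
  by rewrite mem_orderings => /G0.
pose e s := filter (mem D) s.
pose f s := refill (e s) (mv_last v (e s)) s.
have ev s : is_ordering s -> v \in e s by move=> os; rewrite mem_filter /= Dv mem_ordering.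
have ue s : is_ordering s -> uniq (e s) by move=> os; rewrite filter_uniq // ordering_uniq.
have pe s : is_ordering s -> perm_eq (e s) (mv_last v (e s)).
  by move=> os; rewrite perm_sym mv_last_perm ?ev.
have ef s : is_ordering s -> e (f s) = mv_last v (e s).
  by move=> os; apply: filter_refill; rewrite ?pe ?ordering_uniq.
have f_ord s : is_ordering s -> is_ordering (f s).
  move=> os; apply: orderingP => [|u].
    by rewrite map_inj_uniq ?ordering_uniq //; apply/can_inj/transferK; rewrite ?pe ?ue.
  have pe' := pe s os; rewrite perm_sym in pe'.
  have ue' : uniq (mv_last v (e s)) by rewrite (perm_uniq pe') ue.
  by rewrite -(transferK pe' ue' u) map_f ?mem_ordering.
(* The map [mv_last v] has fibres of size [#|V|]; locality allows replacing it by [f], whose fibres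
   have size at most [#|D|]. *)
have -> : \sum_(s <- orderings V) G (mv_last v s) = \sum_(s <- orderings V) G (f s).
  rewrite big_seq [RHS]big_seq; apply: eq_bigr => s; rewrite mem_orderings => os.
  apply: locG; [exact: mv_last_ordering | exact: f_ord |].
  apply: agree_filter; rewrite -/(e (f s)) ef // filter_rcons /= Dv.
  by rewrite filter_rem ?ordering_uniq.
apply: (@ler_sum_fiber _ _ _ _ f (fun s => index v (e s))).
- exact: orderings_uniq.
- by move=> s; rewrite mem_orderings => /G0.
- move=> s; rewrite !mem_orderings => os; split; first exact: f_ord.
  suff <- : size (e s) = #|D| by rewrite index_mem ev.
  rewrite cardE; apply/perm_size/uniq_perm => [||x]; rewrite ?enum_uniq ?ue //.
  by rewrite mem_filter mem_enum /= mem_ordering ?andbT.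
- move=> s t; rewrite !mem_orderings => os ot eqf /= eqi.
  (* Dropping the last entry of [e (f s)] leaves [rem v (e s)], and the rank tells where [v] goes
     back. *)
  have eqr : rem v (e s) = rem v (e t).
    have := congr1 e eqf; rewrite !ef // /mv_last => /rcons_inj[] //.
  have eqe : e s = e t.
    have := take_index_rem v (e s); have := take_index_rem v (e t).
    by rewrite !ev // -eqr -eqi => -> .
  rewrite -(refillK s (pe s os) (ue s os)) -/(f s) eqf eqe.
  by rewrite /f refillK ?pe ?ue.
Qed.

End Orderings.

(** * Planting part of a target ordering at the end *)

Section Plant.
Variables (V : finType) (p : seq V).
Hypothesis op : is_ordering p.
Implicit Types (s l : seq V) (u v : V) (A D : {set V}).

Definition plant A s : seq V :=
  [seq x <- s | x \notin A] ++ [seq x <- p | x \in A].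

Lemma plant_ordering A s : is_ordering s -> is_ordering (plant A s).
Proof.
move=> os; apply: orderingP => [|u]; last first.
  by rewrite mem_cat !mem_filter !mem_ordering //; case: (u \in A).
rewrite cat_uniq !filter_uniq ?ordering_uniq // andbT /=.
by apply/hasPn => u; rewrite !mem_filter => /andP[->].
Qed.

Lemma plant_set0 s : plant set0 s = s.
Proof.
rewrite /plant (eq_filter (a2 := predT)) => [|x]; last by rewrite inE.
rewrite filter_predT (eq_filter (a2 := pred0)) => [|x]; last by rewrite inE.
by rewrite filter_pred0 cats0.
Qed.

Lemma plant_setT s : plant setT s = p.
Proof.
rewrite /plant (eq_filter (a2 := pred0)) => [|x]; last by rewrite inE.
rewrite filter_pred0 (eq_filter (a2 := predT)) => [|x]; last by rewrite inE.
by rewrite filter_predT.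
Qed.

(** Used twice for [A' = A :\ u]: with [D] the complement of [u], the two planted orderings are
    reinsertions of [u] into each other; with [D] a support missing [u], its constraint cannot tell
    them apart. *)
Lemma filter_plant (D : pred V) A A' s : (forall x, D x -> (x \in A) = (x \in A')) ->
  filter D (plant A s) = filter D (plant A' s).
Proof.
move=> eqA; rewrite /plant !filter_cat -!filter_predI; congr (_ ++ _);
  by apply: eq_filter => x /=; case Dx: (D x); rewrite //= eqA.
Qed.

Lemma rem_plant u A s : is_ordering s ->
  rem u (plant A s) = rem u (plant (A :\ u) s).
Proof.
move=> os; rewrite !rem_filter ?ordering_uniq ?plant_ordering //.
by apply: filter_plant => x /= xu; rewrite !inE xu.
Qed.

(** Forcing the suffix [l] means moving its entries last one after another, each move costing a
    factor [#|D|] by [sum_mv_last]. The induction peels off the final entry [v] and passes to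
    [G \o mv_last v], which is still local to [D]. *)
Lemma sum_suffix (R : realFieldType) D l (G : seq V -> R) :
  D != set0 -> local_to D G -> (forall s, is_ordering s -> 0 <= G s) -> uniq l ->
  \sum_(s <- orderings V) G ([seq x <- s | x \notin l] ++ l)
  <= #|D|%:R ^+ size l * \sum_(s <- orderings V) G s.
Proof.
move=> D0; elim/last_ind: l G => [|l v IH] G locG G0.
  move=> _; rewrite mul1r (eq_bigr G) // => s _.
  by rewrite cats0 (eq_filter (a2 := predT)) ?filter_predT.
rewrite rcons_uniq => /andP[lv ul].
have -> : \sum_(s <- orderings V) G ([seq x <- s | x \notin rcons l v] ++ rcons l v) =
    \sum_(s <- orderings V) G (mv_last v ([seq x <- s | x \notin l] ++ l)).
  rewrite big_seq [RHS]big_seq; apply: eq_bigr => s; rewrite mem_orderings => os.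
  rewrite /mv_last rem_filter; last first.
    rewrite cat_uniq (filter_uniq _ (ordering_uniq os)) ul andbT /=.
    by apply/hasPn => u ul'; rewrite mem_filter ul'.
  rewrite filter_cat -filter_predI -rcons_cat; congr (G (rcons (_ ++ _) v)).
    by apply: eq_filter => x; rewrite /= mem_rcons inE negb_or.
  by rewrite -rem_filter // rem_id.
have locG' : local_to D (G \o mv_last v).
  move=> s t os ot Dst; apply: locG; rewrite ?mv_last_ordering //.
  exact: agree_mv_last.
have G0' s : is_ordering s -> 0 <= (G \o mv_last v) s.
  by move=> os; apply/G0/mv_last_ordering.
apply: le_trans (IH _ locG' G0' ul) _.
rewrite size_rcons exprSr -mulrA ler_wpM2l ?exprn_ge0 ?ler0n //.
exact: sum_mv_last.
Qed.

(** The density bound for planted orderings, tested on nonnegative functions that only see [D]. *)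
Lemma sum_plant (R : realFieldType) D A (G : seq V -> R) :
  D != set0 -> local_to D G -> (forall s, is_ordering s -> 0 <= G s) ->
  \sum_(s <- orderings V) G (plant A s)
  <= #|D|%:R ^+ #|A| * \sum_(s <- orderings V) G s.
Proof.
move=> D0 locG G0; pose l := [seq x <- p | x \in A].
have ul : uniq l by rewrite filter_uniq ?ordering_uniq.
have ml x : (x \in l) = (x \in A) by rewrite mem_filter mem_ordering ?andbT.
have sl : size l = #|A|.
  rewrite cardE; apply/perm_size/uniq_perm => [||x]; rewrite ?enum_uniq ?ul //.
  by rewrite ml mem_enum.
rewrite -sl (eq_bigr (fun s => G ([seq x <- s | x \notin l] ++ l))).
  exact: sum_suffix.
by move=> s _; congr (G (_ ++ _)); apply: eq_filter => x; rewrite ml.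
Qed.

End Plant.

(** * Sums over lists of constraints *)

Section InSums.
Variables (R : realFieldType) (T : Type).

(** Constraints carry functions and have no decidable equality, so membership is [List.In] and sums
    are compared by list induction. *)
Lemma ler_sum_In (X : seq T) (F G : T -> R) :
  (forall x, List.In x X -> F x <= G x) -> \sum_(x <- X) F x <= \sum_(x <- X) G x.
Proof.
elim: X => [|x X IH] FG; first by rewrite !big_nil.
by rewrite !big_cons lerD ?FG ?IH //=; [left | move=> y Xy; apply: FG; right].
Qed.

Lemma eq_sum_In (X : seq T) (F G : T -> R) :
  (forall x, List.In x X -> F x = G x) -> \sum_(x <- X) F x = \sum_(x <- X) G x.
Proof.
by move=> FG; apply/eqP; rewrite eq_le !ler_sum_In // => x /FG ->.
Qed.

End InSums.

(** * Locality of the gain, and Moebius coefficients of planted values *)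

Section Gain.
Variables (R : realFieldType) (V : finType) (k : nat) (cs : seq (constraint R V)).
Hypothesis csp : kcsp_instance k cs.
Implicit Types (s t : seq V) (u v : V) (C : constraint R V) (S A : {set V}).

Definition nbhd u : {set V} := u |: \bigcup_(C <- cs | u \in supp C) supp C.

(* The default [0] of the maximum is always attained: [u] can be put back. *)
Definition gain u s : R :=
  \big[Num.max/0]_(i < #|V|) (value cs (ins s u i) - value cs s).

Lemma cval_agree C s t : List.In C cs -> is_ordering s -> is_ordering t ->
  agree (mem (supp C)) s t -> cval C s = cval C t.
Proof.
by move=> /csp[_ _ loc] os ot agr; apply: loc => // a b Ca Cb; apply: agr.
Qed.

Lemma value_ge0 s : is_ordering s -> 0 <= value cs s.
Proof.
move=> os; apply: le_trans (_ : \sum_(C <- cs) 0 <= _); first by rewrite big1.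
by apply: ler_sum_In => C /csp[_ pos _]; apply: pos.
Qed.

Lemma nbhd_neq0 u : nbhd u != set0.
Proof. by apply/set0Pn; exists u; rewrite setU11. Qed.

Lemma supp_sub_nbhd C u : List.In C cs -> u \in supp C -> supp C \subset nbhd u.
Proof.
move=> inC Cu; apply: subset_trans (subsetUr _ _).
elim: cs inC => //= C' X IH [-> | /IH sub]; rewrite big_cons; first by rewrite Cu subsetUl.
by case: ifP => // _; apply: subset_trans (subsetUr _ _).
Qed.

(** At most [B] supports of size at most [k] give [B * k]; the vertex [u] itself is absorbed into
    one more [B], as [1 <= B]. *)
Lemma card_nbhd u B : (1 <= B)%N -> bounded_occ B cs -> (#|nbhd u| <= B * k.+1)%N.
Proof.
move=> B1 /(_ u) occ; apply: leq_trans (leq_card_setU _ _) _.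
rewrite cards1 mulnS leq_add //.
apply: leq_trans (_ : count (fun C => u \in supp C) cs * k <= _)%N; last by rewrite leq_mul.
elim: cs csp {occ} => [|C X IH] cspX; first by rewrite big_nil cards0.
have {}IH := IH (fun C' inC' => cspX C' (or_intror inC')).
have [leC _ _] := cspX C (or_introl erefl).
rewrite big_cons /=; case: ifP => _ //.
by rewrite mulSn (leq_trans (leq_card_setU _ _)) // leq_add.
Qed.

Lemma gain_ge0 u s : 0 <= gain u s.
Proof. exact: bigmax_ge_id. Qed.

Lemma le_gain u s i : (i < #|V|)%N -> value cs (ins s u i) - value cs s <= gain u s.
Proof.
move=> lti; exact: (le_bigmax 0 (fun i : 'I_#|V| => value cs (ins s u i) - value cs s) (Ordinal lti)).
Qed.

Lemma value_rem_le_gain u s t : is_ordering s -> is_ordering t -> rem u t = rem u s ->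
  value cs t - value cs s <= gain u s.
Proof.
move=> os ot eqr; rewrite -[X in value _ X - _](ins_index os ot eqr).
by apply: le_gain; apply: index_ordering.
Qed.

(** Each reinsertion of [u] into [s] is matched by [agree_ins] with one into [t]. Constraints on [u]
    have supports inside [nbhd u] and change by the same amount; the others do not change at all. *)
Lemma gain_agree_le u s t : is_ordering s -> is_ordering t ->
  agree (mem (nbhd u)) s t -> gain u s <= gain u t.
Proof.
move=> os ot st; apply: bigmax_le => [|[i lti] _ /=]; first exact: gain_ge0.
have [j ltj ij] := agree_ins u os ot lti st.
apply: le_trans (le_gain _ _ ltj).
rewrite /value -!sumrB le_eqVlt; apply/orP; left; apply/eqP.
apply: eq_sum_In => C inC.
have [Cu|nCu] := boolP (u \in supp C).
  have sub a : a \in supp C -> a \in nbhd u by apply/subsetP/supp_sub_nbhd.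
  congr (_ - _); apply: cval_agree; rewrite ?ins_ordering //.
    by move=> a b Ca Cb; apply: ij; apply: sub.
  by move=> a b Ca Cb; apply: st; apply: sub.
have ins_id r i' : is_ordering r -> cval C (ins r u i') = cval C r.
  move=> or; apply: cval_agree; rewrite ?ins_ordering // => a b Ca Cb.
  by apply: before_ins => //; [apply: contraNneq nCu => <- | apply: contraNneq nCu => <-].
by rewrite !ins_id // !subrr.
Qed.

Lemma gain_local u : local_to (nbhd u) (gain u).
Proof.
move=> s t os ot st; apply/eqP; rewrite eq_le !gain_agree_le //.
by move=> a b Da Db; rewrite st.
Qed.

Definition total_gain u : R := \sum_(s <- orderings V) gain u s.

Lemma total_gain_ge0 u : 0 <= total_gain u.
Proof. by apply: sumr_ge0 => s _; apply: gain_ge0. Qed.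

Section Target.
Variable p : seq V.
Hypothesis op : is_ordering p.

Definition planted_value A : R := \sum_(s <- orderings V) value cs (plant p A s).

Lemma sum_gain_plant u A j : (#|A| <= j)%N ->
  \sum_(s <- orderings V) gain u (plant p A s) <= #|nbhd u|%:R ^+ j * total_gain u.
Proof.
move=> lej; apply: le_trans (sum_plant op _ (nbhd_neq0 u) (@gain_local u) _) _.
  by move=> s _; apply: gain_ge0.
rewrite ler_wpM2r ?total_gain_ge0 //; apply: ler_weXn2l => //.
by rewrite ler1n card_gt0 nbhd_neq0.
Qed.

(** For each [s] the two planted orderings differ by reinserting [u], so a difference of either sign
    is at most the gain at the ordering that is subtracted. The density bound is therefore applied
    both to [A] and to [A :\ u]. *)
Lemma planted_valueD1 u A : (#|A| <= k)%N ->
  `|planted_value A - planted_value (A :\ u)| <= #|nbhd u|%:R ^+ k * total_gain u.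
Proof.
move=> leA; rewrite /planted_value -sumrB ler_norml -lerNl -sumrN.
have leA' : (#|A :\ u| <= k)%N by apply: leq_trans leA; rewrite subset_leq_card ?subD1set.
apply/andP; split.
  apply: le_trans (sum_gain_plant u leA); rewrite big_seq [leRHS]big_seq.
  apply: ler_sum => s; rewrite mem_orderings => os; rewrite opprB.
  by apply: value_rem_le_gain; rewrite ?plant_ordering // -rem_plant.
apply: le_trans (sum_gain_plant u leA'); rewrite big_seq [leRHS]big_seq.
apply: ler_sum => s; rewrite mem_orderings => os.
by apply: value_rem_le_gain; rewrite ?plant_ordering // -rem_plant.
Qed.

(** The coefficient is linear in the constraints. For each [C] some [u] in [S] lies outside
    [supp C], and pairing [A] with [A :\ u] cancels every term. *)
Lemma moebius_eq0 S : (forall C, List.In C cs -> ~~ (S \subset supp C)) ->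
  moebius planted_value S = 0.
Proof.
move=> nS.
have -> : moebius planted_value S = \sum_(C <- cs)
    moebius (fun A => \sum_(s <- orderings V) cval C (plant p A s)) S.
  rewrite /moebius exchange_big /=; apply: eq_bigr => A _.
  by rewrite -mulr_sumr /planted_value /value [in LHS]exchange_big.
rewrite (eq_sum_In (G := fun=> 0)) ?big1 // => C inC.
have /subsetPn[u Su nCu] := nS C inC.
rewrite (moebius_pair _ Su) big1 // => A _.
rewrite -sumrB big1_seq ?mulr0 //= => s; rewrite mem_orderings => os.
apply/eqP; rewrite subr_eq0; apply/eqP/cval_agree; rewrite ?plant_ordering //.
apply: agree_filter; apply: filter_plant => x /= Cx; rewrite !inE.
by case: eqP nCu Cx => // -> /negbTE /= ->.
Qed.

Lemma moebius_bound u S : u \in S -> (#|S| <= k)%N ->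
  `|moebius planted_value S| <= 2 ^+ k * (#|nbhd u|%:R ^+ k * total_gain u).
Proof.
move=> Su leS; rewrite (moebius_pair _ Su).
apply: le_trans (ler_norm_sum _ _ _) _.
(* Extending the sum to all subsets of [S] gives the factor [2 ^ #|S|], which is at most [2 ^ k]. *)
apply: (@le_trans _ _ (\sum_(A in powerset S) #|nbhd u|%:R ^+ k * total_gain u)).
  rewrite [leRHS](bigID (fun A : {set V} => u \in A)) /= -[leLHS]addr0 lerD //; last first.
    by apply: sumr_ge0 => A _; rewrite mulr_ge0 ?total_gain_ge0 ?exprn_ge0 ?ler0n.
  rewrite [leLHS](eq_bigl (fun A : {set V} => (A \in powerset S) && (u \in A))); last first.
    by move=> A; rewrite powersetE.
  apply: ler_sum => A /andP[]; rewrite powersetE => AS _.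
  rewrite normrM normrX normrN1 expr1n mul1r planted_valueD1 //.
  exact: leq_trans (subset_leq_card AS) leS.
rewrite sumr_const card_powerset -[leLHS]mulr_natl ler_wpM2r //.
  by rewrite mulr_ge0 ?total_gain_ge0 ?exprn_ge0 ?ler0n.
by rewrite -natrX ler_nat leq_exp2l.
Qed.

End Target.
End Gain.

(** * Bounding the optimum by the total gain *)

Lemma ler_In_sum (R : realFieldType) (T : Type) (X : seq T) (F : T -> R) x :
  List.In x X -> (forall y, 0 <= F y) -> F x <= \sum_(y <- X) F y.
Proof.
move=> + F0; elim: X => //= y X IH [<- | /IH le]; rewrite big_cons.
  by rewrite lerDl sumr_ge0.
by rewrite (le_trans le) // lerDr.
Qed.

Section OptBound.
Variables (R : realFieldType) (V : finType) (k B E : nat) (cs : seq (constraint R V)).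
Hypothesis csp : kcsp_instance k cs.
Hypothesis occ : bounded_occ B cs.
Hypothesis leE : forall u, (#|nbhd cs u| <= E)%N.

(** The outer [2 ^+ k] counts the sets [S] inside a support, the inner one the sets [A] in a Moebius
    coefficient; [E%:R ^+ k] is the density bound, and each vertex lies in at most [B] supports. *)
Lemma value_sub_le_total_gain p : is_ordering p ->
  (size (orderings V))%:R * value cs p - \sum_(s <- orderings V) value cs s
  <= (2 ^+ k * (2 ^+ k * E%:R ^+ k) * B%:R) * \sum_u total_gain cs u.
Proof.
move=> op; pose K : R := 2 ^+ k * E%:R ^+ k.
have K0 : 0 <= K by rewrite mulr_ge0 ?exprn_ge0 ?ler0n.
have g0 := @total_gain_ge0 R V cs.
have sg0 (S : {set V}) : 0 <= \sum_(u in S) total_gain cs u by rewrite sumr_ge0.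
have -> : (size (orderings V))%:R * value cs p = planted_value cs p setT.
  rewrite /planted_value (eq_bigr (fun=> value cs p)) => [|s _]; last by rewrite plant_setT.
  by rewrite big_const_seq count_predT iter_addr_0 mulr_natl.
have -> : \sum_(s <- orderings V) value cs s = planted_value cs p set0.
  by apply: eq_bigr => s _; rewrite plant_set0.
rewrite -moebius_inversion -moebius_set0 (bigD1 set0) //= addrAC subrr add0r.
(* Each [S] is charged to every constraint whose support contains it, and the gain of one [u] in [S]
   is enlarged to the whole support. The charge then depends on the constraint alone, which allows
   exchanging the sums. *)
have bound S : S != set0 -> moebius (planted_value cs p) S <=
    \sum_(C <- cs) (if S \subset supp C then K * \sum_(u in supp C) total_gain cs u else 0).
  move=> /set0Pn[u Su].
  have sum0 (C : constraint R V) : 0 <= (if S \subset supp C then K * \sum_(u in supp C) total_gain cs u else 0).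
    by case: ifP => // _; rewrite mulr_ge0.
  have [|nhas] := boolP (has (fun C => S \subset supp C) cs).
    move=> hasC.
    have [C inC SC] : exists2 C, List.In C cs & S \subset supp C.
      elim: (cs) hasC => //= C X IH /orP[SC|/IH[C' inC' SC']]; first by exists C; [left|].
      by exists C' => //; right.
    have := ler_In_sum inC sum0; rewrite SC; apply: le_trans.
    have leS : (#|S| <= k)%N.
      by have [leC _ _] := csp inC; apply: leq_trans leC; apply: subset_leq_card.
    apply: le_trans (ler_norm _) _.
    apply: le_trans (moebius_bound csp op Su leS) _.
    rewrite mulrA ler_pM ?mulr_ge0 ?exprn_ge0 ?ler0n //.
      by rewrite ler_wpM2l ?exprn_ge0 ?ler0n // lerXn2r ?nnegrE ?ler0n ?ler_nat.
    by rewrite (bigD1 u) ?(subsetP SC) //= lerDl sumr_ge0.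
  rewrite (moebius_eq0 csp op) ?sumr_ge0 // => C inC.
  elim: (cs) nhas inC => //= C' X IH; rewrite negb_or => /andP[nC' nX] [<- // | inC].
  exact: IH.
apply: le_trans (ler_sum _ bound) _.
rewrite exchange_big /=.
apply: (@le_trans _ _ (\sum_(C <- cs) (2 ^+ k * K) * \sum_(u in supp C) total_gain cs u)).
  apply: ler_sum_In => C inC; have [leC _ _] := csp inC.
  apply: (@le_trans _ _ (\sum_(S in powerset (supp C)) K * \sum_(u in supp C) total_gain cs u)).
    rewrite big_mkcond [leRHS]big_mkcond; apply: ler_sum => S _; rewrite powersetE.
    by case: ifP => // _; case: ifP => // _; rewrite mulr_ge0.
  rewrite sumr_const card_powerset -[leLHS]mulr_natl mulrA ler_wpM2r //.
  by rewrite ler_wpM2r // natrX ler_weXn2l // ler1n.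
rewrite -mulr_sumr -[leRHS]mulrA ler_wpM2l ?mulr_ge0 ?exprn_ge0 ?ler0n //.
rewrite mulr_sumr; under eq_bigr do rewrite big_mkcond.
rewrite exchange_big /=; apply: ler_sum => u _.
rewrite -big_mkcond /= big_const_seq iter_addr_0 -[leLHS]mulr_natl ler_wpM2r //.
by rewrite ler_nat occ.
Qed.

Lemma Opt_sub_Avg_le_total_gain :
  (size (orderings V))%:R * (Opt cs - Avg cs)
  <= (2 ^+ k * (2 ^+ k * E%:R ^+ k) * B%:R) * \sum_u total_gain cs u.
Proof.
have N0 : 0 < (size (orderings V))%:R :> R by rewrite ltr0n size_orderings_gt0.
rewrite mulrBr lerBlDr -ler_pdivlMl //; set X := (X in _ <= X).
have le_p p : is_ordering p -> value cs p <= X.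
  move=> op; rewrite /X ler_pdivlMl // -lerBlDr /Avg mulrC.
  rewrite mulrCA mulfV ?gt_eqF // mulr1 mulrC.
  exact: value_sub_le_total_gain.
(* The default [0] of the maximum must also be below [X]; it is, because the value of [enum V] is
   nonnegative. *)
rewrite /Opt big_seq; apply: bigmax_le => [|p]; last by rewrite mem_orderings; apply: le_p.
have oV : is_ordering (enum V) by rewrite /is_ordering.
exact: le_trans (value_ge0 csp oV) (le_p _ oV).
Qed.

End OptBound.

(** * Counting estimates for the random picks *)

(** The difference [n ^ n - m ^ n] is [n - m] times a sum of [n] terms, each at least [m ^ n.-1],
    hence at least [n * m ^ n.-1], which is at least [m ^ n]. *)
Lemma double_expn_ltn m n : (m < n)%N -> (2 * m ^ n <= n ^ n)%N.
Proof.
move=> ltmn; rewrite mulSn mul1n -leq_subRL ?leq_exp2r // ?(leq_ltn_trans _ ltmn) //; last first.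
  by rewrite ltnW.
rewrite subn_exp; apply: leq_trans (leq_pmull _ _); last by rewrite subn_gt0.
apply: (@leq_trans (\sum_(i < n) m ^ n.-1)%N).
  by rewrite sum_nat_const card_ord -{1}(ltn_predK ltmn) expnS leq_mul // ltnW.
apply: leq_sum => i _; rewrite -{1}(subnK (_ : i <= n.-1)%N) ?expnD; last by have := ltn_ord i; lia.
rewrite leq_mul //; case: (n.-1 - i)%N => // e.
by rewrite leq_exp2r // ltnW.
Qed.

Lemma prod_threshold n (t : 'I_n) a b :
  (\prod_(i < n) (if i < t then a else if i == t then 1 else b) =
   a ^ t * b ^ (n.-1 - t))%N.
Proof.
rewrite -(big_mkord xpredT (fun i => if i < t then a else if i == t then 1 else b)%N).
rewrite (big_cat_nat (n := t)) ?(ltnW (ltn_ord t)) //= [X in (_ * X)%N]big_ltn //.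
rewrite ltnn eqxx mul1n; congr (_ * _)%N.
  rewrite -[in RHS](subn0 t) -prod_nat_const_nat; apply: eq_big_nat => i /andP[_ ->] //.
rewrite (_ : n.-1 - t = n - t.+1)%N; last by lia.
rewrite -prod_nat_const_nat; apply: eq_big_nat => i /andP[lt _].
by rewrite ltnNge ltnW //= gtn_eqF.
Qed.

(** * Expected progress of the algorithm *)

Section Alg.
Variables (R : realFieldType) (V : finType) (k : nat) (cs : seq (constraint R V)).
Hypothesis csp : kcsp_instance k cs.
Variable tb : nat -> seq V -> V -> nat.
Hypothesis valid : valid_rule cs tb.
Let n := #|V|.
Implicit Types (f : {ffun 'I_n -> V}) (t : 'I_n) (l : seq 'I_n) (s : seq V) (u : V).

Lemma gain_le_step i s u : is_ordering s ->
  value cs s + gain cs u s <= value cs (ins s u (tb i s u)).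
Proof.
move=> os; have [ltn_tb max_tb] := valid i u os.
rewrite -lerBrDl; apply: bigmax_le => [|j _]; last by rewrite lerD2r max_tb.
(* For the default [0] of the maximum: reinserting [u] at its own index gives back [s]. *)
rewrite subr_ge0 -[leLHS](congr1 (value cs) (ins_index os os (erefl (rem u s)))).
by rewrite max_tb // index_ordering.
Qed.

Definition run_steps f l s : seq V :=
  foldl (fun s t => ins s (f t) (tb t s (f t))) s l.

Lemma run_steps_ordering f l s : is_ordering s -> is_ordering (run_steps f l s).
Proof. by elim: l s => //= t l IH s os; apply/IH/ins_ordering. Qed.

Lemma run_steps_agree f l s (D : {set V}) : is_ordering s ->
  (forall t, t \in l -> f t \notin D) -> agree (mem D) s (run_steps f l s).
Proof.
elim: l s => //= t l IH s os nD a b Da Db.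
rewrite -IH ?ins_ordering // => [|t' lt']; last by rewrite nD // inE lt' orbT.
have nt : f t \notin D by rewrite nD ?mem_head.
by rewrite before_ins //; apply: contraNneq nt => <-.
Qed.

(* Then no vertex of [nbhd (f t)], in particular not [f t], has moved before step [t]. *)
Definition fresh f t : bool :=
  [forall t' : 'I_n, (t' < t)%N ==> (f t' \notin nbhd cs (f t))].

(** Induction over prefixes of the run. At a fresh step the current ordering still agrees with [s]
    on [nbhd cs (f t)], so the available gain equals the gain at [s]; the remaining steps lose
    nothing. *)
Lemma run_gain f s : is_ordering s ->
  value cs s + \sum_(t < n | fresh f t) gain cs (f t) s <= value cs (run tb s f).
Proof.
move=> os.
suff H m : (m <= n)%N -> value cs s + \sum_(t < n | fresh f t && (t < m)%N) gain cs (f t) s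
    <= value cs (run_steps f (take m (enum 'I_n)) s).
  have := H n (leqnn n); rewrite take_oversize ?size_enum_ord //.
  by under eq_bigl do rewrite ltn_ord andbT.
elim: m => [_|m IH ltm].
  by rewrite big_pred0 => [|t]; rewrite ?addr0 ?take0 // ltn0 andbF.
pose t := Ordinal ltm.
have -> : take m.+1 (enum 'I_n) = rcons (take m (enum 'I_n)) t.
  by rewrite (take_nth t) ?size_enum_ord // (nth_ord_enum t t).
rewrite /run_steps foldl_rcons -/(run_steps f _ s); set s' := run_steps _ _ _.
have os' : is_ordering s' by apply: run_steps_ordering.
apply: le_trans (gain_le_step t (f t) os').
have -> : \sum_(i < n | fresh f i && (i < m.+1)%N) gain cs (f i) s =
    (if fresh f t then gain cs (f t) s else 0) +
    \sum_(i < n | fresh f i && (i < m)%N) gain cs (f i) s.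
  rewrite big_mkcond (bigD1 t) //= ltnSn andbT; congr (_ + _).
  rewrite [RHS]big_mkcond [RHS](bigD1 t) //= ltnn andbF add0r.
  apply: eq_bigr => i; rewrite -val_eqE /= => nit.
  by rewrite ltnS leq_eqVlt (negbTE nit).
rewrite addrCA addrC lerD ?IH ?(ltnW ltm) //.
case: ifP => [/forallP fr|_]; last exact: gain_ge0.
rewrite le_eqVlt (gain_local csp os os') ?eqxx //.
apply: run_steps_agree => // t' lt'; apply: (implyP (fr t')).
have := lt'; rewrite -(mem_map val_inj) map_take val_enum_ord take_iota mem_iota /=.
by rewrite add0n leq_min => /andP[].
Qed.

(** Once [f t = u] is fixed, freshness constrains each pick separately: before [t] it avoids
    [nbhd cs u], after [t] it is free. So the count is a product. *)
Lemma card_fresh t u :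
  #|[pred f | fresh f t && (f t == u)]| = ((n - #|nbhd cs u|) ^ t * n ^ (n.-1 - t))%N.
Proof.
pose F (t' : 'I_n) : pred V :=
  if (t' < t)%N then [pred v | v \notin nbhd cs u]
  else if t' == t then pred1 u else predT.
rewrite (eq_card (B := family F)) => [|f]; last first.
  rewrite !inE; apply/andP/familyP => [[/forallP fr /eqP ft] t'|fam].
    rewrite /F; case: ifP => lt; first by rewrite inE -ft (implyP (fr t')).
    by case: eqP => // ->; rewrite inE ft.
  have ft : f t = u by have := fam t; rewrite /F ltnn eqxx inE => /eqP.
  split; last by rewrite ft.
  by apply/forallP => t'; apply/implyP => lt; have := fam t'; rewrite /F lt inE ft.
rewrite card_family foldrE big_map big_enum /=.
rewrite (eq_bigr (fun t' : 'I_n => if (t' < t)%N then (n - #|nbhd cs u|)%N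
    else if (t' : nat) == t then 1%N else n)) => [|t' _]; last first.
  rewrite /F; case: ifP => _; first by rewrite -[n](cardC (mem (nbhd cs u))) addKn; apply: eq_card.
  by rewrite val_eqE; case: ifP => _; rewrite ?card1.
exact: prod_threshold.
Qed.

(** With [d = #|nbhd cs u|], the counts form a geometric sum equal to [(n ^ n - (n - d) ^ n) / d],
    and by [double_expn_ltn] the subtracted power is at most half of [n ^ n]. *)
Lemma sum_card_fresh u :
  (n ^ n <= 2 * #|nbhd cs u| * \sum_(t < n) #|[pred f | fresh f t && (f t == u)]|)%N.
Proof.
under eq_bigr do rewrite card_fresh mulnC.
have d_gt0 : (0 < #|nbhd cs u|)%N by rewrite card_gt0 nbhd_neq0.
have d_le : (#|nbhd cs u| <= n)%N by rewrite max_card.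
rewrite -mulnA -{1}(subKn d_le) -subn_exp.
have lt : (n - #|nbhd cs u| < n)%N by lia.
by have := double_expn_ltn lt; lia.
Qed.

Lemma sum_run_ge :
  (n ^ n)%:R * (\sum_(s <- orderings V) value cs s)
  + \sum_u (\sum_(t < n) #|[pred f | fresh f t && (f t == u)]|)%N%:R * total_gain cs u
  <= \sum_(s <- orderings V) \sum_(f : {ffun 'I_n -> V}) value cs (run tb s f).
Proof.
have -> : \sum_u (\sum_(t < n) #|[pred f | fresh f t && (f t == u)]|)%N%:R * total_gain cs u =
    \sum_(s <- orderings V) \sum_(f : {ffun 'I_n -> V})
       \sum_(t < n | fresh f t) gain cs (f t) s.
  under eq_bigr do rewrite /total_gain mulr_sumr.
  rewrite exchange_big /=; apply: eq_bigr => s _.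
  under eq_bigr do rewrite natr_sum mulr_suml.
  rewrite exchange_big [RHS](exchange_big_dep xpredT) //=; apply: eq_bigr => t _.
  rewrite (partition_big (fun f : {ffun 'I_n -> V} => f t) xpredT) //=.
  apply: eq_bigr => u _; rewrite (eq_bigr (fun=> gain cs u s)) => [|f /andP[_ /eqP ->]] //.
  by rewrite sumr_const mulr_natl.
rewrite mulr_sumr -big_split big_seq [leRHS]big_seq /=; apply: ler_sum => s.
rewrite mem_orderings => os; rewrite -[X in X%:R]/(n ^ n)%N.
have -> : (n ^ n)%:R * value cs s = \sum_(f : {ffun 'I_n -> V}) value cs s.
  by rewrite sumr_const card_ffun card_ord mulr_natl.
by rewrite -big_split; apply: ler_sum => f _; apply: run_gain.
Qed.

End Alg.

(** * Combining the two bounds *)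

Unset Implicit Arguments.

Theorem theorem1 (R : realFieldType) (k : nat) (hk : (1 <= k)%N) :
  exists c : R, 0 < c /\
    forall (V : finType) (B : nat) (cs : seq (constraint R V))
           (tb : nat -> seq V -> V -> nat),
      (1 <= B)%N ->
      kcsp_instance k cs ->
      bounded_occ B cs ->
      valid_rule cs tb ->
      expected_alg_value cs tb >=
        Avg cs + c * ((B%:R ^+ (k + 2))^-1) * (Opt cs - Avg cs).
Proof.
(* What remains of the constant in [Opt_sub_Avg_le_total_gain] for [E = B * k.+1] once all powers of
   [B] are taken out. *)
pose K : R := 2 ^+ k * (2 ^+ k * k.+1%:R ^+ k).
have K0 : 0 < K by rewrite /K !mulr_gt0 ?exprn_gt0 ?ltr0n.
have k0 : 0 < k.+1%:R :> R by rewrite ltr0n.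
exists (K * (2 * k.+1%:R))^-1; split; first by rewrite invr_gt0 (mulr_gt0 K0) // mulr_gt0.
move=> V B cs tb B1 csp occ valid.
pose N : R := (size (orderings V))%:R; pose M : R := (#|V| ^ #|V|)%:R.
pose S := \sum_(s <- orderings V) value cs s.
pose G := \sum_u total_gain cs u.
have B0 : 0 < B%:R :> R by rewrite ltr0n.
have N0 : 0 < N by rewrite ltr0n size_orderings_gt0.
(* This covers an empty [V] too, since [0 ^ 0 = 1]. *)
have M0 : 0 < M by rewrite ltr0n expn_gt0; case: #|V|.
have leE u : (#|nbhd cs u| <= B * k.+1)%N by apply: card_nbhd.
have opt : N * (Opt cs - Avg cs) <= K * B%:R ^+ k.+1 * G.
  apply: le_trans (Opt_sub_Avg_le_total_gain csp occ leE) _.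
  rewrite natrM exprMn -/G [B%:R ^+ k.+1]exprS le_eqVlt; apply/orP; left; apply/eqP.
  rewrite /K; move: (k.+1%:R ^+ k) (B%:R ^+ k) (2 ^+ k) => x y z. ring.
have alg : M * S + M * (2 * (B * k.+1)%:R)^-1 * G <= N * M * expected_alg_value cs tb.
  rewrite /expected_alg_value card_ffun card_ord mulrCA mulfV ?mulr1; last by rewrite mulf_neq0 ?gt_eqF.
  apply: le_trans (sum_run_ge csp valid); rewrite lerD2l mulr_sumr ler_sum // => u _.
  rewrite ler_wpM2r ?total_gain_ge0 // ler_pdivrMr ?mulr_gt0 ?ltr0n ?muln_gt0 ?B1 //.
  rewrite -!natrM ler_nat (leq_trans (sum_card_fresh cs u)) //.
  by rewrite [X in (_ <= X)%N]mulnC leq_mul2r leq_mul2l leE !orbT.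
have SE : S = N * Avg cs by rewrite /Avg mulrC mulfVK ?gt_eqF.
(* After clearing the denominators [N * M], the exponent [k + 2] of [B] is made of [k.+1] from [opt]
   and one from the neighbourhood size in [alg]. *)
rewrite -(ler_pM2l (mulr_gt0 N0 M0)); apply: le_trans alg.
rewrite SE mulrDr (mulrC N M) -(mulrA M N (Avg cs)) lerD2l (mulrC M N).
have -> : N * M * ((K * (2 * k.+1%:R))^-1 * (B%:R ^+ (k + 2))^-1 * (Opt cs - Avg cs)) =
    M * (K * (2 * k.+1%:R))^-1 * (B%:R ^+ (k + 2))^-1 * (N * (Opt cs - Avg cs)) by ring.
have -> : M * (2 * (B * k.+1)%:R)^-1 * G =
    M * (K * (2 * k.+1%:R))^-1 * (B%:R ^+ (k + 2))^-1 * (K * B%:R ^+ k.+1 * G).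
  rewrite addn2 natrM [B%:R ^+ k.+2]exprS.
  have Bk : B%:R ^+ k.+1 != 0 :> R by rewrite expf_neq0 ?gt_eqF.
  by field; rewrite Bk nat1r !gt_eqF.
apply: ler_wpM2l opt; rewrite divr_ge0 ?exprn_ge0 ?ler0n //.
by rewrite divr_ge0 ?ler0n // mulr_ge0 ?ltW // mulr_gt0.
Qed.
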